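(* Let $n \ge 2$ and $s \ge 2$ be integers, and let $X^{n,s}$ denote the final outcome of the match-and-add-over rolling scheme with $n$ dice, each having $s$ sides. Then $$\mathbb{E}\left(X^{n,s}\right) = \left(1-s^{1-n}\right)^{-1}\,\frac{n(s+1)}{2}.$$
   Context: Let $n \in \mathbb{N}=\{0,1,2,\dots\}$ and $s \in \mathbb{Z}_+=\{1,2,\dots\}$ be fixed. On a probability space $(\Omega,\mathbb{P})$ let $Z_j^l$, for $j \in \mathbb{Z}_+$ and $l \in \{1,\dots,n\}$, be mutually independent random variables, each uniformly distributed on $\{1,\dots,s\}$: $\mathbb{P}(Z_j^l = m) = 1/s$ for every $m \in \{1,\dots,s\}$. Here $Z_j^l$ is the value of the $l$-th die in the $j$-th set of rolls. Let $M_0 = \Omega$ and, for $j \ge 1$, let $M_j = \{\omega \in \Omega : Z_j^1(\omega) = Z_j^2(\omega) = \cdots = Z_j^n(\omega)\}$ (the event that the $j$-th set of rolls is a match). Define $X_0 = 0$ and, for $j \ge 1$, $$X_j(\omega) = \begin{cases} X_{j-1}(\omega) + \sum_{l=1}^n Z_j^l(\omega) & \text{if } \omega \in \bigcap_{k=0}^{j-1} M_k,\\ X_{j-1}(\omega) & \text{otherwise.}\end{cases}$$ The final outcome of the rolling scheme is $X^{n,s} = \lim_{j\to\infty} X_j$ (a nondecreasing limit, with values in $[0,\infty]$). $\mathbb{E}$ denotes expectation. *)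

(* Defs.v *)
From HB Require Import structures.
From mathcomp Require Import all_boot all_order all_algebra.
From mathcomp Require Import finmap.
From mathcomp Require Import all_classical all_reals all_analysis.

Set Implicit Arguments.
Unset Strict Implicit.
Unset Printing Implicit Defensive.

Import Order.TTheory GRing.Theory Num.Theory.
Import numFieldNormedType.Exports.

Local Open Scope classical_set_scope.
Local Open Scope ring_scope.

Definition mutually_independent (d d' : measure_display) (T : measurableType d)
    (T' : measurableType d') (R : realType) (P : probability T R)
    (I : choiceType) (D : set I) (X : I -> {RV P >-> T'}) : Prop :=
  forall (J : {fset I}) (A : I -> set T'),
    [set` J] `<=` D ->
    (forall i, i \in J -> measurable (A i)) ->
    P (\bigcap_(i in [set` J]) (X i @^-1` A i)) =
      (\prod_(i <- J) P (X i @^-1` A i))%E.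

(* As the s masses add up to 1, X lies in {1, ..., s} almost surely. *)
Definition uniform_die (d : measure_display) (T : measurableType d)
    (R : realType) (P : probability T R) (s : nat) (X : {RV P >-> nat}) : Prop :=
  forall m : nat, (1 <= m <= s)%N -> P (X @^-1` [set m]) = (s%:R^-1)%:E.

(* Sets of rolls are numbered from 1: Z 0 is never used, and 'I_n numbers the
   dice from 0. *)
Definition match_and_add_over_dice (d : measure_display) (T : measurableType d)
    (R : realType) (P : probability T R) (n s : nat)
    (Z : nat -> 'I_n -> {RV P >-> nat}) : Prop :=
  mutually_independent [set i : nat * 'I_n | (1 <= i.1)%N]
    (fun i => Z i.1 i.2) /\
  (forall (j : nat) (l : 'I_n), (1 <= j)%N -> uniform_die s (Z j l)).

Definition match_event (d : measure_display) (T : measurableType d)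
    (R : realType) (P : probability T R) (n : nat)
    (Z : nat -> 'I_n -> {RV P >-> nat}) (j : nat) : set T :=
  if j is 0 then setT
  else [set w | forall l l' : 'I_n, Z j l w = Z j l' w].

Fixpoint running_total (d : measure_display) (T : measurableType d)
    (R : realType) (P : probability T R) (n : nat)
    (Z : nat -> 'I_n -> {RV P >-> nat}) (j : nat) (w : T) : nat :=
  if j is j'.+1 then
    if w \in \bigcap_(k in [set k | (k < j)%N]) match_event Z k
    then (running_total Z j' w + \sum_(l < n) Z j l w)%N
    else running_total Z j' w
  else 0%N.

Definition final_outcome (d : measure_display) (T : measurableType d)
    (R : realType) (P : probability T R) (n : nat)
    (Z : nat -> 'I_n -> {RV P >-> nat}) (w : T) : \bar R :=
  limn (fun j : nat => ((running_total Z j w)%:R : R)%:E).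

(* Main.v *)
(** Round k + 1 contributes exactly when rounds 1, ..., k all match. A round
    matches with probability q = s^(1-n), the sum over the s common values of
    s^(-n), so rounds 1, ..., k all match with probability q^k, independently of
    later rounds. Round k + 1 thus contributes q^k n (s+1)/2 on average, and
    Tonelli turns the expectation into a geometric series of ratio q. *)
Require Import Defs.
From mathcomp Require Import all_boot all_order all_algebra finmap.
From mathcomp Require Import all_classical all_reals all_analysis.
From mathcomp Require Import measurable_realfun ring.

Set Implicit Arguments.
Unset Strict Implicit.
Unset Printing Implicit Defensive.

Import Order.TTheory GRing.Theory Num.Theory.
Import numFieldNormedType.Exports.

Local Open Scope classical_set_scope.
Local Open Scope ring_scope.

(** * Series of real terms in the extended reals *)

Lemma nneseries_finite_support (R : realType) (f : nat -> R) (N : nat) :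
  (forall m, 0 <= f m) -> (forall m, (N <= m)%N -> f m = 0) ->
  (\sum_(0 <= m <oo) (f m)%:E)%E = (\sum_(0 <= m < N) f m)%:E.
Proof.
move=> f_ge0 f0.
rewrite (nneseries_split 0 N) => [|k _]; last by rewrite lee_fin.
rewrite add0n eseries0 ?adde0 ?sumEFin// => m le_Nm _.
by rewrite f0.
Qed.

Lemma nneseries_geometric (R : realType) (a q : R) :
  `|q| < 1 -> (\sum_(0 <= k <oo) (a * q ^+ k)%:E)%E = (a / (1 - q))%:E.
Proof.
move=> q1; apply: cvg_lim => //.
under eq_fun do rewrite sumEFin.
apply: cvg_EFin; first by near=> k.
exact: (cvg_geometric_series q1).
Unshelve. all: by end_near. Qed.

(** * The law of one die *)

(** Extended by 0 to all of [nat], so that events can be split over every natural value. *)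
Definition die_mass (R : realType) (s m : nat) : R :=
  if (1 <= m <= s)%N then s%:R^-1 else 0.

Lemma die_mass_ge0 (R : realType) (s m : nat) : 0 <= die_mass R s m.
Proof. by rewrite /die_mass; case: ifP => // _; rewrite invr_ge0. Qed.

Lemma die_mass_gt (R : realType) (s m : nat) :
  (s < m)%N -> die_mass R s m = 0.
Proof. by rewrite /die_mass ltnNge => /negbTE ->; rewrite andbF. Qed.

(** Only the term [m = 0] differs, and there the mass is 0. The general [g] serves both the powers
    of the mass and the mean. *)
Lemma sum_die_mass (R : realType) (s : nat) (g : nat -> R -> R) :
  (forall m, g m 0 = 0) ->
  \sum_(0 <= m < s.+1) g m (die_mass R s m) =
  \sum_(1 <= m < s.+1) g m s%:R^-1.
Proof.
move=> g0; rewrite big_ltn// /die_mass/= g0 add0r.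
rewrite big_nat [RHS]big_nat; apply: eq_bigr => m; rewrite ltnS => -> //.
Qed.

(** This is the probability that [n] dice match: [s] common values, each of probability [s^(-n)]. *)
Lemma sum_die_mass_exp (R : realType) (s n : nat) : (0 < n)%N -> (0 < s)%N ->
  \sum_(0 <= m < s.+1) die_mass R s m ^+ n = s%:R^-1 ^+ n.-1.
Proof.
move=> n_gt0 s_gt0; rewrite (@sum_die_mass _ _ (fun _ x => x ^+ n)); last first.
  by move=> _; rewrite expr0n gtn_eqF.
rewrite sumr_const_nat subn1/= -[n in _ ^+ n]prednK// exprS -mulrnAl.
by rewrite -(mulr_natl s%:R^-1) mulfV ?mul1r// pnatr_eq0 -lt0n.
Qed.

Lemma die_mean (R : realType) (s : nat) : (0 < s)%N ->
  \sum_(0 <= m < s.+1) m%:R * die_mass R s m = (s%:R + 1) / 2.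
Proof.
move=> s_gt0; rewrite (@sum_die_mass _ _ (fun m x => m%:R * x)); last first.
  by move=> m; rewrite mulr0.
have s0 : s%:R != 0 :> R by rewrite pnatr_eq0 -lt0n.
(* Multiplying by [s] clears the inverse and leaves the sum of the first [s] integers, proved by
   induction. *)
rewrite -big_distrl/=; apply: (mulIf s0); rewrite mulfVK//.
elim: s {s_gt0 s0} => [|s IH]; first by rewrite big_geq// mulr0.
by rewrite big_nat_recr//= IH -!natr1; field.
Qed.

(** The [s] prescribed masses already add up to 1, so the event [B] that the die shows a value in 1,
    ..., [s] has full measure, and any other value lies in its null complement. *)
Lemma uniform_die_mass (d : measure_display) (T : measurableType d)
    (R : realType) (P : probability T R) (s : nat) (X : {RV P >-> nat}) :
  (0 < s)%N -> uniform_die s X ->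
  forall m, P (X @^-1` [set m]) = (die_mass R s m)%:E.
Proof.
move=> s_gt0 uX m; rewrite /die_mass; case: ifPn => [|m_out]; first exact: uX.
have mX k : measurable (X @^-1` [set k]) by exact: measurable_funPTI.
pose B := \bigcup_(k in [set` index_iota 1 s.+1]) X @^-1` [set k].
have PB : P B = 1%E.
  rewrite measure_fin_bigcup//; last 2 first.
  - exact: finite_seq.
  - by move=> i j _ _ [w [/= <- <-]].
  rewrite -fsbig_seq ?iota_uniq//.
  rewrite (eq_big_seq (fun _ => (s%:R^-1 : R)%:E)) => [|k]; last first.
    by rewrite mem_index_iota => ?; exact: uX.
  rewrite sumEFin sumr_const_nat subn1/= -(mulr_natl s%:R^-1) mulfV//.
  by rewrite pnatr_eq0 -lt0n.
have mB : measurable B by apply: bigcup_measurable => k _; exact: mX.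
have PBC : P (~` B) = 0%E by rewrite probability_setC// PB subee.
apply: (@subset_measure0 _ _ _ P _ (~` B)) => //; first exact: measurableC.
move=> w /= Xwm [k /=]; rewrite mem_index_iota ltnS Xwm => km mk.
by move: m_out; rewrite mk km.
Qed.

(** * Matching rounds as countable unions of cylinders *)

Definition cylinder (d : measure_display) (T : measurableType d)
    (R : realType) (P : probability T R) (n : nat)
    (Z : nat -> 'I_n -> {RV P >-> nat})
    (r : seq (nat * 'I_n)) (a : nat * 'I_n -> nat) : set T :=
  [set w | forall i, i \in r -> Z i.1 i.2 w = a i].

(** The condition tested by [running_total] at round [j]; the index 0 being trivial, it concerns
    rounds 1, ..., [j - 1]. *)
Definition all_matched (d : measure_display) (T : measurableType d)
    (R : realType) (P : probability T R) (n : nat)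
    (Z : nat -> 'I_n -> {RV P >-> nat}) (j : nat) : set T :=
  \bigcap_(k in [set k | (k < j)%N]) match_event Z k.

Lemma measurable_cylinder (d : measure_display) (T : measurableType d)
    (R : realType) (P : probability T R) (n : nat)
    (Z : nat -> 'I_n -> {RV P >-> nat}) r a :
  measurable (cylinder Z r a).
Proof.
have -> : cylinder Z r a = \bigcap_(i in [set` r]) Z i.1 i.2 @^-1` [set a i].
  by apply/seteqP; split=> w.
apply: fin_bigcap_measurable; first exact: finite_seq.
by move=> i _; exact: measurable_funPTI.
Qed.

Lemma cylinder_cat (d : measure_display) (T : measurableType d)
    (R : realType) (P : probability T R) (n : nat)
    (Z : nat -> 'I_n -> {RV P >-> nat}) r1 r2 a :
  cylinder Z (r1 ++ r2) a = cylinder Z r1 a `&` cylinder Z r2 a.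
Proof.
apply/seteqP; split=> [w h|w [h1 h2] i].
  by split=> i ri; apply: h; rewrite mem_cat ri ?orbT.
by rewrite mem_cat => /orP[/h1|/h2].
Qed.

Lemma eq_cylinder (d : measure_display) (T : measurableType d)
    (R : realType) (P : probability T R) (n : nat)
    (Z : nat -> 'I_n -> {RV P >-> nat}) r a b :
  {in r, a =1 b} -> cylinder Z r a = cylinder Z r b.
Proof. by move=> ab; apply/seteqP; split=> w h i ri; rewrite h// ab. Qed.

Definition round n (j : nat) : seq (nat * 'I_n) :=
  [seq (j, l) | l <- enum 'I_n].

Lemma uniq_round n j : uniq (round n j).
Proof. by rewrite map_inj_uniq ?enum_uniq// => l l' []. Qed.

Lemma mem_round n j i : (i \in round n j) = (i.1 == j).
Proof.
apply/mapP/eqP => [[l _ ->]//|<-].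
by exists i.2; rewrite ?mem_enum//; case: i.
Qed.

(** Splitting by the common value [m] gives measurability, and reduces matches to cylinders, whose
    probabilities independence provides. *)
Lemma match_event_bigcup (d : measure_display) (T : measurableType d)
    (R : realType) (P : probability T R) (n : nat)
    (Z : nat -> 'I_n -> {RV P >-> nat}) j : (0 < n)%N ->
  match_event Z j.+1 = \bigcup_m cylinder Z (round n j.+1) (fun=> m).
Proof.
move=> n_gt0; apply/seteqP; split=> [w /= h|w [m _ h] l l'].
  exists (Z j.+1 (Ordinal n_gt0) w) => // i.
  by rewrite mem_round => /eqP ->; exact: h.
by rewrite (h (j.+1, l)) ?(h (j.+1, l')) ?mem_round.
Qed.

Lemma measurable_match_event (d : measure_display) (T : measurableType d)
    (R : realType) (P : probability T R) (n : nat)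
    (Z : nat -> 'I_n -> {RV P >-> nat}) j : (0 < n)%N ->
  measurable (match_event Z j).
Proof.
case: j => [|j] n_gt0; first exact: measurableT.
rewrite match_event_bigcup//; apply: bigcup_measurable => m _.
exact: measurable_cylinder.
Qed.

Lemma measurable_all_matched (d : measure_display) (T : measurableType d)
    (R : realType) (P : probability T R) (n : nat)
    (Z : nat -> 'I_n -> {RV P >-> nat}) j : (0 < n)%N ->
  measurable (all_matched Z j).
Proof.
move=> n_gt0; apply: fin_bigcap_measurable; first exact: finite_II.
by move=> k _; exact: measurable_match_event.
Qed.

Lemma all_matchedS (d : measure_display) (T : measurableType d)
    (R : realType) (P : probability T R) (n : nat)
    (Z : nat -> 'I_n -> {RV P >-> nat}) j :
  all_matched Z j.+1 = all_matched Z j `&` match_event Z j.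
Proof.
apply/seteqP; split=> [w h|w [h hj] k /=].
  by split=> [k /= kj|]; apply: h => //=; rewrite ltnS ltnW.
by rewrite ltnS leq_eqVlt => /orP[/eqP->//|/h].
Qed.

Lemma all_matched1 (d : measure_display) (T : measurableType d)
    (R : realType) (P : probability T R) (n : nat)
    (Z : nat -> 'I_n -> {RV P >-> nat}) :
  all_matched Z 1 = setT.
Proof. by apply/seteqP; split=> // w _ [|k]. Qed.

(** * Independence and the probability of successive matches *)

Lemma prob_cylinder (d : measure_display) (T : measurableType d)
    (R : realType) (P : probability T R) (n s : nat)
    (Z : nat -> 'I_n -> {RV P >-> nat}) r a :
  (0 < s)%N -> match_and_add_over_dice s Z -> uniq r ->
  {in r, forall i, (0 < i.1)%N} ->
  P (cylinder Z r a) = (\prod_(i <- r) die_mass R s (a i))%:E.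
Proof.
move=> s_gt0 [indep unif] uniq_r r_gt0.
have := indep [fset i in r]%fset (fun i => [set a i]).
have -> : [set` [fset i in r]%fset] = [set` r].
  by apply/seteqP; split=> i /=; rewrite !inE.
move=> /(_ r_gt0 (fun _ _ => I)) => e.
have -> : cylinder Z r a = \bigcap_(i in [set` r]) Z i.1 i.2 @^-1` [set a i].
  by apply/seteqP; split=> w.
rewrite e big_imfset//= undup_id// -prodEFin !big_seq.
apply: eq_bigr => i ri.
by rewrite (uniform_die_mass s_gt0 (unif _ _ (r_gt0 i ri))).
Qed.

(* The cylinder on later rounds makes the induction on [j] go through: summing
   over the common value of round [j.+1] moves that round into the cylinder. *)
Lemma prob_all_matched_cylinder (d : measure_display) (T : measurableType d)
    (R : realType) (P : probability T R) (n s : nat)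
    (Z : nat -> 'I_n -> {RV P >-> nat}) (j : nat) r a :
  (0 < n)%N -> (0 < s)%N -> match_and_add_over_dice s Z -> uniq r ->
  {in r, forall i, (j < i.1)%N} ->
  P (all_matched Z j.+1 `&` cylinder Z r a) =
  ((s%:R^-1 ^+ n.-1) ^+ j * \prod_(i <- r) die_mass R s (a i))%:E.
Proof.
move=> n_gt0 s_gt0 hZ; elim: j r a => [|j IH] r a uniq_r gt_r.
  by rewrite all_matched1 setTI mul1r; exact: prob_cylinder.
(* Prescribes [m] on round [j.+1] and keeps [a] on [r]; the two do not conflict because [r] lists
   later rounds only. *)
pose b m (i : nat * 'I_n) := if i.1 == j.+1 then m else a i.
pose C m := all_matched Z j.+1 `&` cylinder Z (round n j.+1 ++ r) (b m).
have r_neq i : i \in r -> (i.1 == j.+1) = false.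
  by move=> /gt_r; rewrite ltn_neqAle eq_sym => /andP[/negbTE].
have -> : all_matched Z j.+2 `&` cylinder Z r a = \bigcup_m C m.
  rewrite all_matchedS match_event_bigcup// setI_bigcupr setI_bigcupl.
  apply: eq_bigcupr => m _; rewrite /C cylinder_cat setIA.
  congr (_ `&` _ `&` _); apply: eq_cylinder => i.
    by rewrite mem_round /b => ->.
  by move=> /r_neq; rewrite /b => ->.
rewrite measure_bigcup; last 2 first.
- move=> m _; apply: measurableI; last exact: measurable_cylinder.
  exact: measurable_all_matched.
(* Disjointness: the first die of round [j.+1] determines [m]. *)
- move=> m m' _ _ [w [[_ h] [_ h']]].
  have i_in : (j.+1, Ordinal n_gt0) \in round n j.+1 ++ r.
    by rewrite mem_cat mem_round eqxx.
  by have := h _ i_in; rewrite (h' _ i_in)/= /b/= eqxx.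
set p := \prod_(i <- r) _.
(* Induction hypothesis for the longer list: the [n] dice of round [j.+1] contribute the [n]-th
   power of the mass. *)
have PC m : P (C m) = ((s%:R^-1 ^+ n.-1) ^+ j * die_mass R s m ^+ n * p)%:E.
  rewrite /C IH.
  - rewrite big_cat/= big_map big_enum/= -mulrA; congr (_ * (_ * _))%:E.
      under eq_bigr do rewrite /b/= eqxx.
      by rewrite prodr_const card_ord.
    by rewrite /p !big_seq; apply: eq_bigr => i /r_neq; rewrite /b => ->.
  - rewrite cat_uniq uniq_round uniq_r andbT/=.
    by apply/hasPn => i /r_neq; rewrite mem_round => ->.
  - move=> i; rewrite mem_cat mem_round => /orP[/eqP->//|/gt_r].
    exact: ltn_trans.
rewrite (eq_eseriesl (Q := xpredT)) => [|m]; last by rewrite in_setT.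
rewrite (eq_eseriesr (fun m _ => PC m)).
rewrite (@nneseries_finite_support _ _ s.+1); last 2 first.
- move=> m; rewrite !mulr_ge0 ?exprn_ge0 ?invr_ge0 ?die_mass_ge0//.
  by apply: prodr_ge0 => i _; exact: die_mass_ge0.
- by move=> m /die_mass_gt ->; rewrite expr0n gtn_eqF// mulr0 mul0r.
by rewrite -big_distrl/= -big_distrr/= sum_die_mass_exp// exprSr.
Qed.

(** * Expectations, round by round *)

(** Write [X] as the sum of [m] times the indicator of [X = m], then exchange the sum and the
    integral of nonnegative terms. *)
Lemma ge0_integral_indic_nat (d : measure_display) (T : measurableType d)
    (R : realType) (mu : measure T R) (A : set T) (X : {mfun T >-> nat}) :
  measurable A ->
  (\int[mu]_w (\1_A w * (X w)%:R)%:E)%E =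
  (\sum_(0 <= m <oo) m%:R%:E * mu (A `&` X @^-1` [set m]))%E.
Proof.
move=> mA; pose B m := A `&` X @^-1` [set m].
have mB m : measurable (B m).
  by apply: measurableI => //; exact: measurable_funPTI.
under eq_integral => w _.
  have -> : (\1_A w * (X w)%:R)%:E =
      (\sum_(0 <= m <oo) (m%:R * \1_(B m) w)%:E)%E :> \bar R.
    have B0 m : m != X w -> \1_(B m) w = 0 :> R.
      move=> mX; rewrite indicE memNset// => -[_ /= Xm].
      by rewrite Xm eqxx in mX.
    (* At a fixed [w] only the term [m = X w] survives, the last one below this bound. *)
    rewrite (@nneseries_finite_support _ _ (X w).+1); last 2 first.
    - by move=> m; rewrite mulr_ge0.
    - by move=> m Xm; rewrite B0 ?mulr0// gtn_eqF.
    rewrite big_nat_recr//= big_nat big1 ?add0r => [|m /= mX]; last first.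
      by rewrite B0 ?mulr0// ltn_eqF.
    rewrite mulrC; congr (_ * _)%:E; rewrite !indicE in_setI.
    have -> : w \in X @^-1` [set X w] by apply/mem_set.
    by rewrite andbT.
  over.
have mindic m : measurable_fun setT (EFin \o (\1_(B m) : T -> R)).
  by apply/measurable_EFinP; exact: measurable_indic.
rewrite integral_nneseries; last 3 first.
- exact: measurableT.
- by move=> m; exact/measurable_EFinP/measurable_funM.
- by move=> m w _; rewrite lee_fin mulr_ge0.
apply: eq_eseriesr => m _.
under eq_integral do rewrite EFinM.
rewrite ge0_integralZl_EFin//; last exact: mindic.
by rewrite integral_indic// setIT.
Qed.

(** Unfolds the recursion into a sum of nonnegative gains, one per die and round, to which Tonelli
    applies. *)
Lemma running_totalE (d : measure_display) (T : measurableType d)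
    (R : realType) (P : probability T R) (n : nat)
    (Z : nat -> 'I_n -> {RV P >-> nat}) (j : nat) (w : T) :
  (running_total Z j w)%:R%:E =
  (\sum_(0 <= k < j) \sum_(l < n)
     (\1_(all_matched Z k.+1) w * (Z k.+1 l w)%:R)%:E)%E :> \bar R.
Proof.
elim: j => [|j IH]; first by rewrite big_nil.
rewrite big_nat_recr//= -IH sumEFin -big_distrr/= indicE.
rewrite /all_matched; case: ifPn => _; last by rewrite mul0r adde0.
by rewrite mul1r natrD natr_sum EFinD.
Qed.

Lemma integral_round_gain (d : measure_display) (T : measurableType d)
    (R : realType) (P : probability T R) (n s : nat)
    (Z : nat -> 'I_n -> {RV P >-> nat}) (j : nat) (l : 'I_n) :
  (0 < s)%N -> match_and_add_over_dice s Z ->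
  (\int[P]_w (\1_(all_matched Z j.+1) w * (Z j.+1 l w)%:R)%:E)%E =
  ((s%:R + 1) / 2 * (s%:R^-1 ^+ n.-1) ^+ j)%:E.
Proof.
move=> s_gt0 hZ; have n_gt0 : (0 < n)%N by case: n l {Z hZ} => // -[].
rewrite ge0_integral_indic_nat; last exact: measurable_all_matched.
have Pm m : P (all_matched Z j.+1 `&` Z j.+1 l @^-1` [set m]) =
    ((s%:R^-1 ^+ n.-1) ^+ j * die_mass R s m)%:E.
  (* A die of round [j.+1] comes after the [j] matched rounds, so a one-entry cylinder meets the
     condition on [r]. *)
  have -> : Z j.+1 l @^-1` [set m] = cylinder Z [:: (j.+1, l)] (fun=> m).
    apply/seteqP; split=> [w h i|w h]; first by rewrite inE => /eqP ->.
    by apply: (h (j.+1, l)); rewrite inE.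
  rewrite (prob_all_matched_cylinder _ n_gt0 s_gt0 hZ) ?big_seq1// => i.
  by rewrite inE => /eqP ->.
rewrite (eq_eseriesr (g := fun m =>
  ((s%:R^-1 ^+ n.-1) ^+ j * (m%:R * die_mass R s m))%:E)) => [|m _]; last first.
  by rewrite mulrCA [RHS]EFinM; congr (_ * _)%E; exact: Pm.
rewrite (@nneseries_finite_support _ _ s.+1); last 2 first.
- by move=> m; rewrite !mulr_ge0 ?exprn_ge0 ?invr_ge0 ?die_mass_ge0.
- by move=> m /die_mass_gt ->; rewrite !mulr0.
by rewrite -big_distrr/= die_mean// mulrC.
Qed.

Theorem theorem2p5 (d : measure_display) (T : measurableType d) (R : realType)
    (P : probability T R) (n s : nat) (hn : (2 <= n)%N) (hs : (2 <= s)%N)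
    (Z : nat -> 'I_n -> {RV P >-> nat})
    (hZ : match_and_add_over_dice s Z) :
  (\int[P]_w final_outcome Z w)%E =
    ((1 - s%:R ^ (1 - n%:Z))^-1 * (n%:R * (s%:R + 1) / 2))%:E.
Proof.
have n_gt0 : (0 < n)%N by exact: ltnW.
have s_gt0 : (0 < s)%N by exact: ltnW.
set q : R := s%:R^-1 ^+ n.-1.
have -> : s%:R ^ (1 - n%:Z) = q.
  by rewrite /q -[n in LHS]prednK// intS opprD addNKr -exprz_inv.
(* Here [2 <= n] makes the exponent positive and [2 <= s] makes the base less than 1. *)
have q1 : `|q| < 1.
  rewrite ger0_norm ?exprn_ge0 ?invr_ge0// exprn_ilt1 ?invr_ge0//.
    by rewrite -lt0n -ltnS prednK.
  by rewrite invf_lt1 ?ltr1n ?ltr0n.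
under eq_integral => w _.
  have -> : final_outcome Z w = (\sum_(0 <= k <oo) \sum_(l < n)
      (\1_(all_matched Z k.+1) w * (Z k.+1 l w)%:R)%:E)%E.
    by rewrite /final_outcome; under eq_fun do rewrite running_totalE.
  over.
have mZ k l : measurable_fun setT
    (EFin \o (fun w => \1_(all_matched Z k.+1) w * (Z k.+1 l w)%:R : R)).
  apply/measurable_EFinP/measurable_funM.
    by apply: measurable_indic; exact: measurable_all_matched.
  exact: measurableT_comp.
(* Tonelli, first over the rounds, then over the [n] dice of a round. *)
rewrite integral_nneseries; last 3 first.
- exact: measurableT.
- by move=> k; apply: emeasurable_sum => l; exact: mZ.
- by move=> k w _; apply: sume_ge0 => l _; rewrite lee_fin mulr_ge0.
rewrite (eq_eseriesr (g := fun k => (n%:R * (s%:R + 1) / 2 * q ^+ k)%:E)).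
  by rewrite nneseries_geometric// mulrC.
move=> k _; rewrite (ge0_integral_sum P measurableT (mZ k)); last first.
  by move=> l w _; rewrite lee_fin mulr_ge0.
under eq_bigr do rewrite (integral_round_gain _ _ s_gt0 hZ).
by rewrite sumEFin sumr_const card_ord -/q -!mulrA mulr_natl.
Qed.
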